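(* Consider the Lie algebra of type $G_2$. Let $\ell\ge 1$ be an integer, $\lambda=\ell\varpi_2$, and $\mu=m_1\varpi_1+m_2\varpi_2$ with $m_1,m_2$ nonnegative integers satisfying $3\ell-1=2m_1+3m_2$. Then $\mathcal{A}(\lambda,\mu)=\{1,s_1\}$. Moreover, $\mathcal{A}(0,\mu)=\emptyset$ for any $\mu=m_1\varpi_1+m_2\varpi_2$ with $m_1,m_2$ nonnegative integers satisfying $3\cdot 0-1=2m_1+3m_2$.
   Context: Type $G_2$: simple roots $\alpha_1$ (short) and $\alpha_2$ (long), positive roots $\alpha_1,\alpha_2,\alpha_1+\alpha_2,2\alpha_1+\alpha_2,3\alpha_1+\alpha_2,3\alpha_1+2\alpha_2$; fundamental weights $\varpi_1=2\alpha_1+\alpha_2$, $\varpi_2=3\alpha_1+2\alpha_2$; $\rho=\varpi_1+\varpi_2$. $W$ is the Weyl group generated by the simple reflections $s_1,s_2$ (reflections in $\alpha_1,\alpha_2$), $1$ its identity. Kostant's partition function $\wp(\xi)$ counts the ways to write $\xi$ as a nonnegative integral combination of positive roots, and $\mathcal{A}(\lambda,\mu)=\{\sigma\in W:\wp(\sigma(\lambda+\rho)-(\mu+\rho))>0\}$. *)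

(* Defs.v *)
From HB Require Import structures.
From mathcomp Require Import all_boot all_order all_algebra.
From mathcomp Require Import finmap.
From mathcomp Require Import boolp classical_sets functions cardinality.

Set Implicit Arguments.
Unset Strict Implicit.
Unset Printing Implicit Defensive.

Import Order.TTheory GRing.Theory Num.Theory.
Local Open Scope classical_set_scope.
Local Open Scope ring_scope.

(* The rational span of the roots, in coordinates with respect to the simple
   roots; linear maps are matrices acting on columns on the left, so that the
   product of matrices is composition. *)
Definition wt := 'cV[rat]_2.

Definition alpha1 : wt := delta_mx 0 0.
Definition alpha2 : wt := delta_mx 1 0.

Definition pos_roots : 6.-tuple wt :=
  [tuple alpha1; alpha2; alpha1 + alpha2; 2 *: alpha1 + alpha2;
         3 *: alpha1 + alpha2; 3 *: alpha1 + 2 *: alpha2].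

Definition varpi1 : wt := 2 *: alpha1 + alpha2.
Definition varpi2 : wt := 3 *: alpha1 + 2 *: alpha2.
Definition rho : wt := varpi1 + varpi2.

(* The invariant inner product, normalized so that short roots have square
   length 2: (alpha1, alpha1) = 2, (alpha2, alpha2) = 6 and
   (alpha1, alpha2) = -3. *)
Definition gram : 'M[rat]_2 :=
  \matrix_(i, j) (if i == j then if i == 0 then 2 else 6 else -3).

Definition dotw (u v : wt) : rat := (u^T *m gram *m v) 0 0.

Definition refl (a : wt) : 'M[rat]_2 :=
  1 - (2 / dotw a a) *: (a *m (a^T *m gram)).

Lemma reflE (a v : wt) : refl a *m v = v - (2 * dotw a v / dotw a a) *: a.
Proof.
rewrite /refl mulmxBl mul1mx; congr (_ - _).
rewrite -scalemxAl -(mulmxA a) [_ *m v]mx11_scalar -/(dotw a v).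
by rewrite mul_mx_scalar scalerA mulrAC.
Qed.

Definition s1 : 'M[rat]_2 := refl alpha1.
Definition s2 : 'M[rat]_2 := refl alpha2.

Inductive weyl : set 'M[rat]_2 :=
| weyl_one : weyl 1
| weyl_s1 : weyl s1
| weyl_s2 : weyl s2
| weyl_mul g h : weyl g -> weyl h -> weyl (g * h)
| weyl_inv g : weyl g -> weyl g^-1.

Definition partitions (xi : wt) : set {ffun 'I_6 -> nat} :=
  [set c | \sum_(i < 6) (c i)%:R *: tnth pos_roots i = xi].

(* [fset_set] sends infinite sets to the empty set; [partitions_finite] below
   shows that this default value is never used. *)
Definition kostant (xi : wt) : nat := #|` fset_set (partitions xi)|%fset.

Lemma partitions_finite (xi : wt) : finite_set (partitions xi).
Proof.
pose ht (v : wt) : rat := v 0 0 + v 1 0.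
have ht_ge1 i : 1 <= ht (tnth pos_roots i).
  by case: i => -[|[|[|[|[|[|//]]]]]] ?; rewrite /ht (tnth_nth 0) /= !mxE.
pose N := (Num.truncn (ht xi)).+1.
pose F (c : {ffun 'I_6 -> 'I_N}) : {ffun 'I_6 -> nat} :=
  [ffun i => nat_of_ord (c i)].
apply: (@sub_finite_set _ _ (F @` setT)); last first.
  exact/finite_image/finite_finset.
move=> c /= cE.
have lec i : (c i < N)%N.
  rewrite -(ltr_nat rat); apply: le_lt_trans (truncnS_gt (ht xi)).
  have -> : ht xi = \sum_(j < 6) (c j)%:R * ht (tnth pos_roots j).
    rewrite -cE /ht !summxE -big_split /=; apply: eq_bigr => j _.
    by rewrite !mxE mulrDr.
  rewrite (bigD1 i) //= -[leLHS]addr0 lerD //.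
    by rewrite ler_peMr // ler0n.
  apply: sumr_ge0 => j _; rewrite mulr_ge0 ?ler0n //.
  exact: le_trans ler01 (ht_ge1 j).
exists [ffun i => Ordinal (lec i)] => //.
by apply/ffunP => i; rewrite !ffunE.
Qed.

Definition altset (lambda mu : wt) : set 'M[rat]_2 :=
  [set g | weyl g /\
           (0 < kostant (g *m (lambda + rho) - (mu + rho))%R)%N].

(* Main.v *)
Require Import Defs.
From HB Require Import structures.
From mathcomp Require Import all_boot all_order all_algebra.
From mathcomp Require Import finmap.
From mathcomp Require Import boolp classical_sets functions cardinality.
From mathcomp Require Import zify ring lra.

Import Order.TTheory GRing.Theory Num.Theory.
Local Open Scope classical_set_scope.
Local Open Scope ring_scope.

(** Since every positive root is a nonnegative integral combination of the
    simple roots, the partition function is positive exactly on the cone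
    N alpha1 + N alpha2.  In simple-root coordinates lambda + rho is
    (3 l + 5, 2 l + 3), and the hypothesis says that mu + rho is
    (3 l + 4, m1 + 2 m2 + 3), where 3 (2 l - m1 - 2 m2) = m1 + 2.  Hence 1 and
    s1 produce the differences (1, k) and (0, k) with k = 2 l - m1 - 2 m2 > 0,
    while each of the ten other elements of W makes one coordinate negative. *)

Lemma ord2_eq01 (i : 'I_2) : i = 0 \/ i = 1.
Proof. by case: i => -[|[|//]] lti; [left | right]; apply: val_inj. Qed.

Lemma wt_eqP (u v : wt) : u = v <-> u 0 0 = v 0 0 /\ u 1 0 = v 1 0.
Proof.
split=> [-> //|[uv0 uv1]]; apply/matrixP => i j; rewrite (ord1 j).
by case: (ord2_eq01 i) => ->.
Qed.

Lemma kostant_gt0P (xi : wt) :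
  (0 < kostant xi)%N <-> exists p q : nat, xi 0 0 = p%:R /\ xi 1 0 = q%:R.
Proof.
have finP := partitions_finite xi; rewrite /kostant.
have partE (c : {ffun 'I_6 -> nat}) (i : 'I_2) :
    (\sum_(j < 6) (c j)%:R *: tnth pos_roots j) i 0
    = \sum_(j < 6) (c j)%:R * (tnth pos_roots j i 0).
  by rewrite summxE; apply: eq_bigr => j _; rewrite mxE.
split=> [|[p [q [xi0 xi1]]]].
- rewrite cardfs_gt0 => /fset0Pn [c].
  rewrite in_fset_set // inE /partitions /= => <-.
  rewrite !partE !big_ord_recl !big_ord0 !(tnth_nth 0) /= !mxE /=.
  set c0 := c _; set c1 := c _; set c2 := c _.
  set c3 := c _; set c4 := c _; set c5 := c _.
  exists (c0 + c2 + 2 * c3 + 3 * c4 + 3 * c5)%N.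
  exists (c1 + c2 + c3 + c4 + 2 * c5)%N.
  by split; ring.
- rewrite cardfs_gt0; apply/fset0Pn.
  (* [p] copies of [alpha1] and [q] of [alpha2]; the default value 0 of [nth] gives the other four
     roots coefficient 0. *)
  exists [ffun i : 'I_6 => nth 0%N [:: p; q] i].
  rewrite in_fset_set // inE /partitions /=; apply/wt_eqP.
  rewrite !partE !big_ord_recl !big_ord0 !ffunE !(tnth_nth 0) /= !mxE /=.
  by rewrite xi0 xi1; split; ring.
Qed.

(* The quadruple (a, b, c, d) stands for the matrix [[a, b], [c, d]]; over
   [int] the group law of W becomes computable. *)
Definition quad := (int * int * int * int)%type.

Definition mx_of_quad (q : quad) : 'M[rat]_2 :=
  let: (a, b, c, d) := q in
  \matrix_(i, j) (if i == 0 then if j == 0 then a else b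
                  else if j == 0 then c else d)%:~R.

Definition quad_mul (q q' : quad) : quad :=
  let: (a, b, c, d) := q in let: (a', b', c', d') := q' in
  (a * a' + b * c', a * b' + b * d', c * a' + d * c', c * b' + d * d').

(* The identity, s1, s2, s1 s2, s2 s1 and s1 s2 s1, followed by their negatives:
   the longest element of W is -1. *)
Definition weyl_quads : seq quad :=
  [:: (1, 0, 0, 1); (-1, 3, 0, 1); (1, 0, 1, -1);
      (2, -3, 1, -1); (-1, 3, -1, 2); (-2, 3, -1, 2);
      (-1, 0, 0, -1); (1, -3, 0, -1); (-1, 0, -1, 1);
      (-2, 3, -1, 1); (1, -3, 1, -2); (2, -3, 1, -2)].

Lemma mx2P (A B : 'M[rat]_2) :
  A 0 0 = B 0 0 -> A 0 1 = B 0 1 -> A 1 0 = B 1 0 -> A 1 1 = B 1 1 -> A = B.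
Proof.
move=> e00 e01 e10 e11; apply/matrixP => i j.
by case: (ord2_eq01 i) => ->; case: (ord2_eq01 j) => ->.
Qed.

Lemma mx_of_quadM (q q' : quad) :
  mx_of_quad (quad_mul q q') = mx_of_quad q * mx_of_quad q'.
Proof.
move: q q' => [[[a b] c] d] [[[a' b'] c'] d'].
by apply: mx2P; rewrite !mxE !big_ord_recl big_ord0 !mxE /= addr0 intrD !intrM.
Qed.

Lemma mx_of_quad1 : mx_of_quad (1, 0, 0, 1) = 1.
Proof. by apply: mx2P; rewrite !mxE. Qed.

Lemma s1E : s1 = mx_of_quad (-1, 3, 0, 1).
Proof.
apply: mx2P; rewrite /s1 /refl /dotw;
  rewrite ?(mxE, big_ord_recl, big_ord0) /=; by vm_compute.
Qed.

Lemma s2E : s2 = mx_of_quad (1, 0, 1, -1).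
Proof.
apply: mx2P; rewrite /s2 /refl /dotw;
  rewrite ?(mxE, big_ord_recl, big_ord0) /=; by vm_compute.
Qed.

Lemma weyl_quads_mul (q q' : quad) :
  q \in weyl_quads -> q' \in weyl_quads -> quad_mul q q' \in weyl_quads.
Proof.
have /allrelP closed :
    allrel (fun q q' => quad_mul q q' \in weyl_quads) weyl_quads weyl_quads.
  by vm_compute.
exact: closed.
Qed.

Lemma weyl_quads_inv (q : quad) : q \in weyl_quads ->
  exists2 q', q' \in weyl_quads & quad_mul q q' = (1, 0, 0, 1).
Proof.
have /allP inv :
    all (fun q => has (fun q' => quad_mul q q' == (1, 0, 0, 1)) weyl_quads)
        weyl_quads by vm_compute.
by move=> /inv /hasP [q' q'W /eqP]; exists q'.
Qed.

(** The list contains the generators and is closed under products and inverses, so it exhausts W by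
    induction on the generation of [g]. *)
Lemma weyl_mx_of_quad (g : 'M[rat]_2) :
  weyl g -> exists2 q, q \in weyl_quads & g = mx_of_quad q.
Proof.
elim=> {g} [|||g h _ [q qW ->] _ [q' q'W ->]|g _ [q qW ->]].
- by exists (1, 0, 0, 1); rewrite ?mx_of_quad1.
- by exists (-1, 3, 0, 1); rewrite ?s1E.
- by exists (1, 0, 1, -1); rewrite ?s2E.
- by exists (quad_mul q q'); rewrite ?mx_of_quadM ?weyl_quads_mul.
- have [q' q'W qq'] := weyl_quads_inv _ qW; exists q' => //.
  have qq'1 : mx_of_quad q * mx_of_quad q' = 1.
    by rewrite -mx_of_quadM qq' mx_of_quad1.
  (* The inverse of a non-unit is a default value; here the right inverse makes the square matrix a
     unit, so [q'] does represent the inverse. *)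
  have qU : mx_of_quad q \is a GRing.unit by have [] := mulmx1_unit qq'1.
  by apply: (mulrI qU); rewrite mulrV // qq'1.
Qed.

Lemma altset_shiftE (l m1 m2 : nat) (a b c d : int) :
  let xi := mx_of_quad (a, b, c, d) *m (l%:R *: varpi2 + rho)
            - (m1%:R *: varpi1 + m2%:R *: varpi2 + rho) in
  xi 0 0 = a%:~R * (3 * l%:R + 5) + b%:~R * (2 * l%:R + 3)
           - (2 * m1%:R + 3 * m2%:R + 5) /\
  xi 1 0 = c%:~R * (3 * l%:R + 5) + d%:~R * (2 * l%:R + 3)
           - (m1%:R + 2 * m2%:R + 3).
Proof. by split; rewrite !(mxE, big_ord_recl, big_ord0) /=; ring. Qed.

Theorem theorem1p3 :
  (forall l m1 m2 : nat, (1 <= l)%N ->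
     3 * l%:Z - 1 = 2 * m1%:Z + 3 * m2%:Z ->
     altset (l%:R *: varpi2) (m1%:R *: varpi1 + m2%:R *: varpi2) = [set 1; s1])
  /\
  (forall m1 m2 : nat,
     3 * 0%:Z - 1 = 2 * m1%:Z + 3 * m2%:Z ->
     altset 0 (m1%:R *: varpi1 + m2%:R *: varpi2) = set0).
Proof.
(* For weight 0 the hypothesis equates -1 with a nonnegative integer. *)
split=> [l m1 m2 l1 eZ|m1 m2]; last by lia.
have eQ : 3 * l%:R - 1 = 2 * m1%:R + 3 * m2%:R :> rat.
  have := congr1 (fun z : int => z%:~R : rat) eZ.
  by rewrite !(intrD, intrM, intrN).
have [k ek] : exists k, (2 * l = m1 + 2 * m2 + k)%N.
  (* The subtraction does not truncate, as three times the difference is [m1 + 2]. *)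
  by exists (2 * l - (m1 + 2 * m2))%N; lia.
have kQ : 2 * l%:R = m1%:R + 2 * m2%:R + k%:R :> rat.
  by rewrite -!natrM -!natrD ek.
clear l1 eZ ek; apply/seteqP; split=> g /=; last first.
  case=> ->; split; try by constructor.
  - apply/kostant_gt0P; exists 1%N, k.
    rewrite -mx_of_quad1; have [-> ->] := altset_shiftE l m1 m2 1 0 0 1.
    by split; lra.
  - apply/kostant_gt0P; exists 0%N, k.
    rewrite s1E; have [-> ->] := altset_shiftE l m1 m2 (-1) 3 0 1.
    by split; lra.
case=> /weyl_mx_of_quad [[[[a b] c] d] qW ->] /kostant_gt0P [p [q]].
have [-> ->] := altset_shiftE l m1 m2 a b c d.
move: (ler0n rat p) (ler0n rat q) (ler0n rat l).
move: (ler0n rat m1) (ler0n rat m2).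
move: qW; rewrite !inE.
move=> /orP [/eqP [-> -> -> ->] *|/orP [/eqP [-> -> -> ->] *|]].
- by left; exact: mx_of_quad1.
- by right; exact/esym/s1E.
(* For s2 and s2 s1 the first coordinate is still 1 and 0, but the second is -(m1 + 3 m2 + 2)/3 and
   -(m1 + 3 m2 + 5)/3. For the other eight elements the first coordinate is already negative. *)
by do ?[case/orP]; move=> /eqP [-> -> -> ->] ? ? ? ? ? [? ?]; exfalso; lra.
Qed.
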